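(* Let $\mathscr{I}$ be a non-empty set. For each $i\in\mathscr{I}$ let $\lambda_i\geqslant 1$ be a cardinal, let $S_i$ be a Hausdorff totally countably compact semitopological monoid with zero, and let $B^0_{\lambda_i}(S_i)$ be a Hausdorff countably compact topological Brandt $\lambda_i^0$-extension of $S_i$. Suppose that the Tychonoff product $\prod\{S_i\colon i\in\mathscr{I}\}$ is a totally countably compact space. Then the direct product $\prod\{B^0_{\lambda_i}(S_i)\colon i\in\mathscr{I}\}$ with the Tychonoff topology is a totally countably compact semitopological semigroup.
   Context: All topological spaces are Hausdorff. A semitopological semigroup is a Hausdorff topological space with a separately continuous associative operation; a semitopological monoid is a semitopological semigroup with identity. Direct products of semigroups carry the coordinatewise operation. Brandt $\lambda^0$-extension: for a monoid $S$ with zero $0_S$ and a cardinal $\lambda\geqslant 1$, $B^0_\lambda(S)$ is the set $\{(\alpha,s,\beta)\colon \alpha,\beta\in\lambda,\ s\in S\setminus\{0_S\}\}\sqcup\{0\}$ with the operation in which $0$ is the zero and $(\alpha,a,\beta)\cdot(\gamma,b,\delta)$ equals $(\alpha,ab,\delta)$ if $\beta=\gamma$ and $ab\neq 0_S$, and equals $0$ otherwise. For $\alpha,\beta\in\lambda$ put $S_{\alpha,\beta}=\{(\alpha,s,\beta)\colon s\in S\setminus\{0_S\}\}\cup\{0\}$. Topological Brandt $\lambda^0$-extension: for a semitopological monoid $(S,\tau)$ with zero, it is $B^0_\lambda(S)$ with a Hausdorff topology $\tau_B$ such that $(B^0_\lambda(S),\tau_B)$ is a semitopological semigroup and, for some $\alpha\in\lambda$,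 the map $0_S\mapsto 0$, $s\mapsto(\alpha,s,\alpha)$ ($s\neq 0_S$) is a homeomorphism of $(S,\tau)$ onto the subspace $S_{\alpha,\alpha}$. A space is countably compact if each countable open cover has a finite subcover, and totally countably compact if every countably infinite subset contains an infinite subset with compact closure. *)

(* Defs.v *)
From HB Require Import structures.
From mathcomp Require Import all_boot all_classical.
From mathcomp Require Import topology.

Set Implicit Arguments.
Unset Strict Implicit.
Unset Printing Implicit Defensive.

Local Open Scope classical_set_scope.

Definition countably_compact (T : topologicalType) : Prop :=
  forall F : set (set T),
    countable F -> F `<=` open -> \bigcup_(U in F) U = [set: T] ->
    exists G : set (set T),
      [/\ finite_set G, G `<=` F & \bigcup_(U in G) U = [set: T]].

Definition totally_countably_compact (T : topologicalType) : Prop :=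
  forall A : set T, countable A -> infinite_set A ->
    exists B : set T, [/\ B `<=` A, infinite_set B & compact (closure B)].

Definition homeomorphism_onto (X Y : topologicalType) (f : X -> Y)
    (A : set Y) : Prop :=
  [/\ continuous f, set_bij [set: X] A f &
      exists2 g : Y -> X, cancel f g & {within A, continuous g}].

(* The two structures on the carrier are unrelated here: separate continuity
   is imposed by semitopological_semigroup. *)
#[short(type="topologicalMagmaType")]
HB.structure Definition TopologicalMagma := {T of Magma T & Topological T}.

Definition semitopological_semigroup (T : topologicalMagmaType) : Prop :=
  [/\ hausdorff_space T,
      associative (fun x y : T => (x * y)%g),
      forall a : T, continuous (fun x : T => (a * x)%g) &
      forall a : T, continuous (fun x : T => (x * a)%g)].

HB.mixin Record hasAbsorbing S of Magma S := {
  absorb : S;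
  absorb_mulg : left_zero absorb (fun x y : S => (x * y)%g);
  mulg_absorb : right_zero absorb (fun x y : S => (x * y)%g)
}.

#[short(type="monoidWithZeroType")]
HB.structure Definition MonoidWithZero := {S of Monoid S & hasAbsorbing S}.

#[short(type="topologicalMonoidWithZeroType")]
HB.structure Definition TopologicalMonoidWithZero :=
  {S of MonoidWithZero S & Topological S}.

Section Brandt.
Variables (lambda : choiceType) (S : monoidWithZeroType).

(* [None] is the zero 0 of B^0_lambda(S). *)
Definition brandt : Type :=
  option (lambda * {s : S | s != absorb} * lambda).

HB.instance Definition _ := Choice.on brandt.

(* The triple (alpha, s, beta), read as 0 when s = 0_S. *)
Definition brandt_triple (alpha : lambda) (s : S) (beta : lambda) : brandt :=
  if insub s is Some u then Some (alpha, u, beta) else None.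

Definition brandt_mul (x y : brandt) : brandt :=
  match x, y with
  | Some (alpha, a, beta), Some (gamma, b, delta) =>
      if beta == gamma then brandt_triple alpha (val a * val b)%g delta
      else None
  | _, _ => None
  end.

HB.instance Definition _ := hasMul.Build brandt brandt_mul.

(* The subset S_{alpha,beta}. *)
Definition brandt_block (alpha beta : lambda) : set brandt :=
  [set brandt_triple alpha s beta | s in [set s : S | s != absorb]]
  `|` [set None].

End Brandt.

(* A topology on brandt lambda S, given by its family of open sets. *)
Definition brandt_topology (lambda : choiceType) (S : monoidWithZeroType) :=
  isOpenTopological (brandt lambda S).

Definition topBrandt (lambda : choiceType) (S : monoidWithZeroType)
  (tau : brandt_topology lambda S) : Type := brandt lambda S.

Section TopBrandt.
Variables (lambda : choiceType) (S : monoidWithZeroType).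
Variable tau : brandt_topology lambda S.

HB.instance Definition _ := Choice.on (topBrandt tau).
HB.instance Definition _ := Magma.on (topBrandt tau).
HB.instance Definition _ : isOpenTopological (topBrandt tau) := tau.

End TopBrandt.

Definition topological_brandt_extension (lambda : choiceType)
    (S : topologicalMonoidWithZeroType) (tau : brandt_topology lambda S) :
    Prop :=
  semitopological_semigroup (topBrandt tau) /\
  exists alpha : lambda,
    homeomorphism_onto
      (fun s : S => brandt_triple alpha s alpha : topBrandt tau)
      (brandt_block alpha alpha).

Section ProductMagma.
Variables (I : Type) (T : I -> magmaType).

Definition prod_mul (x y : prod_topology T) : prod_topology T :=
  fun i => (x i * y i)%g.

HB.instance Definition _ := hasMul.Build (prod_topology T) prod_mul.

End ProductMagma.

HB.instance Definition _ (I : Type) (T : I -> topologicalMagmaType) :=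
  Magma.on (prod_topology T).

(* Main.v *)
Require Import Defs.
From mathcomp Require Import all_boot all_classical.
From mathcomp Require Import topology.

Set Implicit Arguments.
Unset Strict Implicit.
Unset Printing Implicit Defensive.

Local Open Scope classical_set_scope.

(** Spread one copy of S over all the blocks S_{a,b} of the Brandt extension B:
    send (s, (a, b)) to (a, s, b), and (s, oo) to 0, where (a, b) ranges over
    the discrete set of pairs of indices and oo is the point at infinity of its
    one-point compactification K. This map S * K -> B is onto. It is continuous
    at the points (s, (a, b)) because each block is a two-sided translate of the
    block on which the topology of S is prescribed
    ([brandt_triple_continuous]), and at the points (s, oo) because, B being
    countably compact, every neighbourhood of 0 contains all but finitely many
    blocks ([brandt_zero_nbhs]).

    Taking products over all i, the product of the B_i is a continuous image of
    (product of the S_i) * (product of the K_i). The first factor is totally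
    countably compact by hypothesis and the second is compact by Tychonoff's
    theorem. Total countable compactness survives multiplication by a compact
    space and passes to Hausdorff continuous images
    ([totally_countably_compact_image_prod]). No diagonal extraction over the
    coordinates takes place, so the index set may be of any cardinality. *)

(** * Product topologies *)

Lemma continuous_prod_topology (I : Type) (K : I -> topologicalType)
    (T : topologicalType) (f : T -> prod_topology K) :
  (forall i, continuous (fun x => f x i)) -> continuous f.
Proof.
move=> f_cts x; apply/cvg_sup => i U.
rewrite (@nbhsE (initial_topology (@^~ i))) => -[_ [[V oV <-] Vfx] VU].
rewrite /= nbhs_simpl; apply: (filterS VU).
by apply: (f_cts i x); exact: open_nbhs_nbhs.
Qed.

Lemma continuous_coordinatewise (I : Type) (X K Y : I -> topologicalType)
    (g : forall i, X i * K i -> Y i) : (forall i, continuous (g i)) ->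
  continuous (fun xk : prod_topology X * prod_topology K =>
    (fun i => g i (xk.1 i, xk.2 i)) : prod_topology Y).
Proof.
move=> g_cts; apply: continuous_prod_topology => i xk.
apply: (@continuous_comp _ _ _
  (fun xk : prod_topology X * prod_topology K => (xk.1 i, xk.2 i)) (g i));
  last exact: g_cts.
have fst_i : xk'.1 i @[xk' --> xk] --> xk.1 i.
  exact: (continuous_comp cvg_fst (@proj_continuous {classic I} X i xk.1)).
have snd_i : xk'.2 i @[xk' --> xk] --> xk.2 i.
  exact: (continuous_comp cvg_snd (@proj_continuous {classic I} K i xk.2)).
exact: cvg_pair fst_i snd_i.
Qed.

Section ProductOfSemigroups.
Variables (I : Type) (B : I -> topologicalMagmaType).
Hypothesis B_sg : forall i, semitopological_semigroup (B i).

Lemma semitopological_semigroup_prod :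
  semitopological_semigroup (prod_topology B).
Proof.
have proj_cts i : continuous (fun x : prod_topology B => x i).
  exact: (@proj_continuous {classic I} B i).
split.
- by apply: (@hausdorff_product {classic I} B) => i; case: (B_sg i).
- move=> x y z; apply: functional_extensionality_dep => i.
  by case: (B_sg i) => _ mulA _ _; exact: mulA.
- move=> a; apply: continuous_prod_topology => i x.
  case: (B_sg i) => _ _ mull _; apply: continuous_comp (mull _ _).
  exact: proj_cts.
- move=> a; apply: continuous_prod_topology => i x.
  case: (B_sg i) => _ _ _ mulr; apply: continuous_comp (mulr _ _).
  exact: proj_cts.
Qed.

End ProductOfSemigroups.

(** * Images of totally countably compact spaces *)

(** Lift the points of A to X * K along f. Either the first components of the
    lifts form an infinite set, and total countable compactness of X applies to
    it, or infinitely many points of A share one first component. In both cases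
    an infinite part B of A is contained in f (C * K) with C compact; this image
    is compact, and closed since Y is Hausdorff. *)
Lemma totally_countably_compact_image_prod (X K Y : topologicalType)
    (f : X * K -> Y) :
    totally_countably_compact X -> compact [set: K] -> hausdorff_space Y ->
    continuous f -> range f = [set: Y] ->
  totally_countably_compact Y.
Proof.
move=> X_tcc K_cpt Y_T2 f_cts f_surj A A_cnt A_inf.
have /choice[g gK] y : exists xk, f xk = y.
  by have : range f y by [rewrite f_surj]; case=> xk _ <-; exists xk.
pose p y := (g y).1.
suff [B [C [BA B_inf C_cpt BC]]] : exists B, exists C : set X,
    [/\ B `<=` A, infinite_set B, compact C & p @` B `<=` C].
  exists B; split=> //; rewrite -precompactE.
  have fCK_cpt : compact (f @` (C `*` [set: K])).
    apply: continuous_compact; last exact: compact_setX.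
    exact: continuous_subspaceT.
  apply: (@precompact_subset _ _ (f @` (C `*` [set: K]))).
    by move=> y By; exists (g y); [split=> //; apply: BC; exists y|exact: gK].
  by rewrite precompact_closed //; exact: compact_closed.
have [pA_fin|pA_inf] := pselect (finite_set (p @` A)).
- have [x [_ Bx_inf]] : exists x, (p @` A) x /\
      infinite_set (A `&` [set y | p y = x]).
    apply/not_existsP => allfin; apply: A_inf.
    apply: (@sub_finite_set _ _ (\bigcup_(x in p @` A)
       (A `&` [set y | p y = x]))).
      by move=> y Ay; exists (p y); [exists y|].
    apply: bigcup_finite => // x pAx; apply: contrapT => inf.
    by apply: (allfin x); split.
  exists (A `&` [set y | p y = x]), [set x]; split=> //.
  + exact: compact_set1.
  + by move=> _ [y [_ <-] <-].
- have [|D [DpA D_inf D_cpt]] := X_tcc (p @` A) _ pA_inf.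
    exact: (card_le_trans (card_image_le _ _) A_cnt).
  exists (A `&` p @^-1` D), (closure D); split=> //.
  + move=> /(finite_image p); apply: contra_not D_inf; apply: sub_finite_set.
    by move=> x Dx; have [y Ay pyx] := DpA x Dx; exists y; rewrite /= ?pyx.
  + by move=> _ [y [_ Dpy] <-]; apply: subset_closure.
Qed.

(** * Brandt extensions *)

Lemma brandt_triple_absorb (lambda : choiceType) (S : monoidWithZeroType)
    (a b : lambda) : brandt_triple a (absorb : S) b = None.
Proof. by rewrite /brandt_triple insubF //= eqxx. Qed.

Lemma brandt_tripleM (lambda : choiceType) (S : monoidWithZeroType)
    (a b c : lambda) (s t : S) :
  (brandt_triple a s b * brandt_triple b t c)%g = brandt_triple a (s * t)%g c.
Proof.
have [->|s0] := eqVneq s absorb.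
  by rewrite absorb_mulg !brandt_triple_absorb.
have [->|t0] := eqVneq t absorb.
  rewrite mulg_absorb !brandt_triple_absorb.
  by rewrite -[LHS]/(brandt_mul _ _); case: (brandt_triple a s b) => [[[]]|].
rewrite -[LHS]/(brandt_mul _ _) /(brandt_triple a s b) /(brandt_triple b t c).
by rewrite !insubT /= eqxx.
Qed.

Lemma brandt_tripleM_neq (lambda : choiceType) (S : monoidWithZeroType)
    (a b c d : lambda) (s t : S) : b != c ->
  (brandt_triple a s b * brandt_triple c t d)%g = None.
Proof.
move=> /negPf bc; rewrite -[LHS]/(brandt_mul _ _) /brandt_triple /=.
by case: insubP => [u _ _|_]; case: insubP => [v _ _|_] //=; rewrite bc.
Qed.

Lemma brandt_triple_val (lambda : choiceType) (S : monoidWithZeroType)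
    (a b : lambda) (u : {s : S | s != absorb}) :
  brandt_triple a (val u) b = Some (a, u, b).
Proof. by rewrite /brandt_triple valK. Qed.

Section Brandt.
Variables (lambda : choiceType) (S : topologicalMonoidWithZeroType).
Variable tau : brandt_topology lambda S.
Hypothesis tau_ext : topological_brandt_extension tau.
Local Notation B := (topBrandt tau).

(** The block S_{a,b} with the common zero removed. *)
Definition brandt_cell (ab : lambda * lambda) : set B :=
  [set x | if x is Some (a, _, b) then (a, b) = ab else False].

(** The product (a, 1, a) * x * (b, 1, b) is x when x is in S_{a,b} and 0
    otherwise, so the cell is the preimage of the open set of nonzero elements
    under a composite of two translations. *)
Lemma brandt_cell_open ab : open (brandt_cell ab).
Proof.
case: ab => a b; case: tau_ext => -[B_T2 _ mull mulr] _.
pose h (x : B) : B :=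
  (((brandt_triple a 1%g a : B) * x)%g * (brandt_triple b 1%g b : B))%g.
have h_cts : continuous h.
  by move=> x; apply: continuous_comp (mull _ _) (mulr _ _).
have hE : brandt_cell (a, b) = h @^-1` (~` [set (None : B)]).
  apply/funext => -[[[a' s] b']|]; apply/propext; last first.
    split=> // hN; apply: hN.
    by rewrite /h; case: (brandt_triple a 1%g a) => [[[]]|].
  rewrite /= -brandt_triple_val /h.
  have [->|ana'] := eqVneq a' a; last first.
    rewrite brandt_tripleM_neq 1?eq_sym//.
    by split=> [[aa']|]; [rewrite aa' eqxx in ana'|].
  have [->|bnb'] := eqVneq b' b; last first.
    rewrite brandt_tripleM brandt_tripleM_neq //.
    by split=> [[bb']|]; [rewrite bb' eqxx in bnb'|].
  by rewrite !brandt_tripleM mul1g mulg1 brandt_triple_val.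
rewrite hE; apply: open_comp => [x _|]; first exact: h_cts.
by apply: closed_openC; apply/accessible_closed_set1/hausdorff_accessible.
Qed.

(** The topology of S is prescribed on a single diagonal block S_{c,c}; the
    identity (a, s, b) = (a, 1, c) * (c, s, c) * (c, 1, b) carries it to every
    other block. *)
Lemma brandt_triple_continuous a b :
  continuous (fun s : S => brandt_triple a s b : B).
Proof.
case: tau_ext => -[_ _ mull mulr] [c [c_cts _ _]].
have -> : (fun s : S => brandt_triple a s b : B) =
    (fun s => (brandt_triple a 1%g c : B) * (brandt_triple c s c : B) *
      (brandt_triple c 1%g b : B))%g.
  by apply/funext => s; rewrite !brandt_tripleM mul1g mulg1.
move=> s; apply: continuous_comp (mulr _ _).
by apply: continuous_comp (mull _ _); exact: c_cts.
Qed.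

Hypothesis B_cc : countably_compact B.

(** If this failed, infinitely many cells, say those indexed by a countably infinite
    set E, would have points outside an open neighbourhood V of 0. Let W be the union
    of V and of the cells not indexed by E. The sets W `|` cell with index in E
    form a countable open cover, and none of them can be left out: a point of
    the cell outside V is covered by no other member. *)
Lemma brandt_zero_nbhs (U : set B) : nbhs (None : B) U ->
  finite_set [set ab | ~ brandt_cell ab `<=` U].
Proof.
rewrite nbhsE => -[V [oV V0] VU].
apply: (@sub_finite_set _ _ [set ab | ~ brandt_cell ab `<=` V]).
  by move=> ab; apply: contra_not => /subset_trans; exact.
apply: contrapT => /infiniteP/card_subP[E E_nat EV].
have E_inf : infinite_set E by rewrite (eq_finite_set E_nat); exact: infinite_nat.
pose W := V `|` \bigcup_(ab in ~` E) brandt_cell ab.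
pose H ab := W `|` brandt_cell ab.
have oW : open W.
  by apply: openU => //; apply: bigcup_open => ab _; exact: brandt_cell_open.
have H_uniq ab : E ab -> exists x, forall cd, E cd -> H cd x <-> cd = ab.
  move=> Eab; have [x cx nVx] : exists2 x, brandt_cell ab x & ~ V x.
    by have /existsNP[x /not_implyP[cx nVx]] := EV _ Eab; exists x.
  have cell_x cd : brandt_cell cd x -> cd = ab.
    by case: x cx {nVx} => [[[a s] b]|] //= <- <-.
  exists x => cd _; split=> [[[|[ef nEef /cell_x efab]]|]|->].
  - by [].
  - by rewrite efab in nEef.
  - exact: cell_x.
  - by right.
have [||| G [G_fin GF GT]] := B_cc (F := H @` E).
- apply: (card_le_trans (card_image_le _ _)).
  by have [] := (card_eqPle E [set: nat]).1 E_nat.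
- by move=> _ [ab _ <-]; apply: openU => //; exact: brandt_cell_open.
- apply/seteqP; split=> // x _.
  have [cd Ecd] := infinite_setN0 E_inf.
  (* W alone is not a member of the cover: the points of W are covered by
     H cd, for any cd in E. *)
  case: x => [[[a s] b]|]; last by exists (H cd); [exists cd|left; left].
  have [Eab|nEab] := pselect (E (a, b)).
    by exists (H (a, b)); [exists (a, b)|right].
  by exists (H cd); [exists cd|left; right; exists (a, b)].
have HEG : H @` E `<=` G.
  move=> _ [ab Eab <-]; have [x xP] := H_uniq _ Eab.
  have [D GD Dx] : (\bigcup_(D in G) D) x by rewrite GT.
  have [cd Ecd HD] := GF _ GD.
  by move: Dx; rewrite -HD => /(xP _ Ecd) <-; rewrite HD.
apply: E_inf; rewrite -(eq_finite_set (inj_card_eq (f := H) _)).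
  exact: sub_finite_set HEG G_fin.
move=> ab cd; rewrite !inE => Eab Ecd Hab_cd.
have [x xP] := H_uniq _ Ecd.
by apply/(xP _ Eab); rewrite Hab_cd; apply/(xP _ Ecd).
Qed.

Local Notation K := (one_point_compactification (discrete_topology
  (lambda * lambda)%type)).

Definition brandt_spread (sk : S * K) : B :=
  if sk.2 is Some (a, b) then brandt_triple a sk.1 b else None.

Lemma brandt_spread_continuous : continuous brandt_spread.
Proof.
move=> [s [[a b]|]] U.
- move=> /(brandt_triple_continuous (x := s)) sU.
  exists ([set t | U (brandt_triple a t b)], Some @` [set (a, b)]).
    split=> //=.
    apply: one_point_compactification_some_nbhs.
    exact: (@discrete_set1 (discrete_topology (lambda * lambda)%type) (a, b)).
  by move=> [t _] [/= Ut [_ -> <-]].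
- (* A basic neighbourhood of the point at infinity removes finitely many
     pairs; remove the ones whose cells are not contained in U. *)
  move=> /[dup] /nbhs_singleton U0 /brandt_zero_nbhs N_fin.
  exists (setT, (Some @` (~` [set ab | ~ brandt_cell ab `<=` U])) `|` [set None]).
    split; first exact: filterT.
    exists [set ab | ~ brandt_cell ab `<=` U] => //.
    split; first exact: finite_compact.
    exact: discrete_closed.
  move=> [t _] [_ /= [[[a b] /= /contrapT abU <-]|->]] //=.
  rewrite /brandt_spread /=.
  have [->|t0] := eqVneq t absorb; first by rewrite brandt_triple_absorb.
  by apply: abU; rewrite /brandt_triple insubT.
Qed.

Lemma brandt_spread_surj : range brandt_spread = [set: B].
Proof.
apply/seteqP; split=> // -[[[a s] b]|] _; last by exists (absorb, None).
by exists (val s, Some (a, b)) => //=; exact: brandt_triple_val.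
Qed.

End Brandt.

Theorem theorem2p7 (I : Type) (lambda : I -> choiceType)
    (S : I -> topologicalMonoidWithZeroType)
    (tau : forall i : I, brandt_topology (lambda i) (S i))
    (I_nonempty : inhabited I)
    (lambda_ge1 : forall i : I, inhabited (lambda i))
    (S_semitop : forall i : I, semitopological_semigroup (S i))
    (S_tcc : forall i : I, totally_countably_compact (S i))
    (B_ext : forall i : I, topological_brandt_extension (tau i))
    (B_cc : forall i : I, countably_compact (topBrandt (tau i)))
    (prodS_tcc : totally_countably_compact (prod_topology S)) :
  semitopological_semigroup (prod_topology (fun i : I => topBrandt (tau i))) /\
  totally_countably_compact (prod_topology (fun i : I => topBrandt (tau i))).
Proof.
have B_sg i : semitopological_semigroup (topBrandt (tau i)).
  by case: (B_ext i).
have prodB_sg := semitopological_semigroup_prod B_sg.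
split=> //.
pose K i : topologicalType := one_point_compactification
  (discrete_topology (lambda i * lambda i)%type).
pose f (xk : prod_topology S * prod_topology K) :
    prod_topology (fun i => topBrandt (tau i)) :=
  fun i => brandt_spread (tau i) (xk.1 i, xk.2 i).
apply: (@totally_countably_compact_image_prod _ _ _ f) => //.
- have := @tychonoff {classic I} K (fun=> setT)
    (fun i => one_point_compactification_compact).
  by congr (compact _); apply/seteqP.
- by case: prodB_sg.
- apply: (continuous_coordinatewise (g := fun i => brandt_spread (tau i))).
  by move=> i; exact: brandt_spread_continuous.
- apply/seteqP; split=> // y _.
  have /(_ _)/cid-/all_sig[g gP] i :
      exists sk, brandt_spread (tau i) sk = y i.
    have : range (brandt_spread (tau i)) (y i) by rewrite brandt_spread_surj.
    by case=> sk _ <-; exists sk.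
  exists (fun i => (g i).1, fun i => (g i).2) => //.
  apply: functional_extensionality_dep => i.
  by rewrite /f /= -surjective_pairing.
Qed.
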